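(* (Tropical Farkas Lemma for STM) Let $(\mathcal T,\Sigma)$ be a full generic signed tropical matroid. Then exactly one of the following holds: (i) some contraction of $\mathcal T$ contains a feasible covector; (ii) $\mathcal T$ contains a totally infeasible covector.
   Context: Notation: $[m]=\{1,\dots,m\}$. Subgraphs $G$ of the complete bipartite graph $K_{d,n}$ on $[d]\sqcup[n]$ are identified with their edge sets $\subseteq[d]\times[n]$; nodes in $[d]$ are coordinate nodes, nodes in $[n]$ are apex nodes. Put $\operatorname{conv}(G)=\operatorname{conv}\{(e_j,e_i)\mid (i,j)\in G\}\subset\mathbb R^n\times\mathbb R^d$. A signed tropical $(n,d)$-matroid (STM) is a pair $(\mathcal S,\Sigma)$ where $\mathcal S$ is a set of subgraphs of $K_{d,n}$ and $\Sigma=(\sigma_{ji})\in\{+,-,\bullet\}^{n\times d}$ such that, with the finity graph $\mathcal F=\bigcup_{G\in\mathcal S}G$, one has $\sigma_{ji}=\bullet\Leftrightarrow(i,j)\notin\mathcal F$, and: (1) no graph in $\mathcal S$ has an isolated node in $[n]$; (2) if $H\in\mathcal S$ then all subgraphs $G$ of $H$ without isolated node in $[n]$ for which $\operatorname{conv}(G)$ is a face of $\operatorname{conv}(H)$ are in $\mathcal S$; (3) each point of $\operatorname{conv}(\mathcal F)$ lies in $\operatorname{conv}(H)$ for some $H\in\mathcal S$; (4) for $G\ne H$ in $\mathcal S$, $\operatorname{conv}(G)\cap\operatorname{conv}(H)$ is empty or a face of both. Graphs in $\mathcal S$ are called covectors (covector graphs). An edge $(i,j)$ is positive or negative according to $\sigma_{ji}=+$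 or $-$. The STM is full if $\mathcal F=K_{d,n}$; generic if all its graphs are forests (equivalently, the corresponding subdivision is a triangulation). Contraction: for nonempty $I\subseteq[d]$, $\mathcal T|_I$ is the set of graphs of $\mathcal T$ in which all nodes of $[d]\setminus I$ are isolated, with these nodes deleted (and the corresponding columns of $\Sigma$ deleted); $\mathcal T|_{[d]}=\mathcal T$. A covector is infeasible if some apex node is only incident with negative edges, and feasible otherwise. It is totally infeasible if it is infeasible and every coordinate node is incident with a negative edge. *)

(* Defs.v *)
From mathcomp Require Import all_boot all_order all_algebra.
From mathcomp Require Import all_classical all_reals.
Set Implicit Arguments.
Unset Strict Implicit.
Unset Printing Implicit Defensive.
Import Order.TTheory GRing.Theory Num.Theory.

Local Open Scope ring_scope.

Variant sign := SPos | SNeg | SBullet.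

(* Edge sets of subgraphs of K_{d,n}: an edge (i, j) joins the coordinate node
   i : 'I_d to the apex node j : 'I_n. *)
Definition bigraph (d n : nat) := {set 'I_d * 'I_n}.

Section Graph.
Variables d n : nat.
Implicit Type G : bigraph d n.

Definition no_isolated_apex G : Prop :=
  forall j : 'I_n, exists i : 'I_d, (i, j) \in G.

Definition adjacent G : rel ('I_d + 'I_n) := fun u v =>
  match u, v with
  | inl i, inr j | inr j, inl i => (i, j) \in G
  | _, _ => false
  end.

(* The sequence [:: u; v] is a [cycle] of the relation [adjacent G] whenever uv
   is an edge, hence the bound 2. *)
Definition forest G : Prop :=
  forall c : seq ('I_d + 'I_n),
    uniq c -> cycle (adjacent G) c -> (size c <= 2)%N.

End Graph.

Section Polytope.
Variable R : realType.

(* Faces are cut out by valid linear inequalities, so that the empty set and P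
   itself are faces of P. *)
Definition is_face (V : lmodType R) (F P : set V) : Prop :=
  exists (phi : {scalar V}) (b : R),
    (forall x, P x -> phi x <= b) /\ (forall x, F x <-> P x /\ phi x = b).

Definition edge_point (d n : nat) (p : 'I_d * 'I_n) : 'rV[R]_n * 'rV[R]_d :=
  (delta_mx 0 p.2, delta_mx 0 p.1).

Definition conv_graph (d n : nat) (G : bigraph d n) :
    set ('rV[R]_n * 'rV[R]_d) :=
  fun x => exists lam : 'I_d * 'I_n -> R,
    [/\ forall p, p \in G -> 0 <= lam p,
        \sum_(p in G) lam p = 1
      & x = \sum_(p in G) lam p *: edge_point p].

End Polytope.

Arguments conv_graph R {d n} G.

Section SignedTropicalMatroid.
Variables d n : nat.
Implicit Types (T : {set bigraph d n}) (Sigma : 'M[sign]_(n, d)).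

Definition finity_graph T : bigraph d n := finset.cover T.

Record signed_tropical_matroid (R : realType) T Sigma : Prop := {
  stm_sign : forall i j, Sigma j i = SBullet <-> (i, j) \notin finity_graph T;
  stm_apex : forall G, G \in T -> no_isolated_apex G;
  stm_face : forall G H : bigraph d n, H \in T -> G \subset H ->
    no_isolated_apex G -> is_face (conv_graph R G) (conv_graph R H) -> G \in T;
  stm_cover : forall x, conv_graph R (finity_graph T) x ->
    exists2 H, H \in T & conv_graph R H x;
  stm_inter : forall G H, G \in T -> H \in T -> G <> H ->
    (conv_graph R G `&` conv_graph R H = set0)%classic \/
    (is_face (conv_graph R G `&` conv_graph R H)%classic (conv_graph R G) /\
     is_face (conv_graph R G `&` conv_graph R H)%classic (conv_graph R H))
}.

Definition full T : Prop := forall i j, (i, j) \in finity_graph T.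

Definition generic T : Prop := forall G, G \in T -> forest G.

Definition infeasible Sigma (G : bigraph d n) : Prop :=
  exists j, forall i, (i, j) \in G -> Sigma j i = SNeg.

Definition feasible Sigma (G : bigraph d n) : Prop := ~ infeasible Sigma G.

Definition totally_infeasible Sigma (G : bigraph d n) : Prop :=
  infeasible Sigma G /\
  forall i, exists2 j, (i, j) \in G & Sigma j i = SNeg.

(* After the deletion of the coordinate nodes outside I, the remaining ones are
   relabelled increasingly by 'I_#|I| through [enum_val]. *)
Definition delete_coord (I : {set 'I_d}) (G : bigraph d n) : bigraph #|I| n :=
  [set p : 'I_#|I| * 'I_n | (enum_val p.1, p.2) \in G]%SET.

Definition contraction T (I : {set 'I_d}) : {set bigraph #|I| n} :=
  [set delete_coord I G | G in T & [forall p in G, p.1 \in I]]%SET.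

Definition contraction_sign Sigma (I : {set 'I_d}) : 'M[sign]_(n, #|I|) :=
  \matrix_(j, k) Sigma j (enum_val k).

End SignedTropicalMatroid.

Definition exactly_one (A B : Prop) : Prop := (A \/ B) /\ ~ (A /\ B).

(* Main.v *)
Require Import Defs.
From mathcomp Require Import all_boot all_order all_algebra.
From mathcomp Require Import all_classical all_reals.
From mathcomp Require Import fintype finset bigop.
Set Implicit Arguments.
Unset Strict Implicit.
Unset Printing Implicit Defensive.
Import Order.TTheory GRing.Theory Num.Theory.
Local Open Scope ring_scope.

(** Label every edge by one of its ends: a negative edge by its coordinate node,
    any other edge by its apex node.  Alternative (i) then says that some
    covector carries all the apex labels, and alternative (ii) that some
    covector carries all the coordinate labels: a feasible covector has all the
    apex labels, so exclusivity makes a covector with all the coordinate labels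
    infeasible.  The statement thus is a Sperner lemma for triangulations of the
    product of two simplices.

    A nonnegative weight on the edges of K_{d,n} is a transport plan, and the
    point it defines is its pair of marginals.  For the complex K of all faces
    of covectors, the axioms of a triangulation become: every pair of marginals
    is realised on some face ([flow_cover]), and by only one plan supported on a
    face of K ([flow_unique]).

    Exclusivity.  If G has all apex labels and H all coordinate labels, then
    walking along an edge of H from a coordinate node to an apex node and along
    an edge of G back to a coordinate node permutes some nonempty set of
    coordinate nodes.  The edges of G and the edges of H used there form two
    plans with the same marginals and disjoint supports, against uniqueness
    ([no_both_labels]).

    Existence.  Restrict to the first a.+1 apex nodes and the first b.+1
    coordinate nodes.  A door is a face with a + b edges whose labels are exactly
    the first a apex nodes and the first b coordinate nodes; a room is a face
    with one more edge and at least these labels.  A door lies in exactly one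
    room if it misses a node, that is, if it lies on the boundary of the product
    of simplices, and otherwise in none or two ([rooms_apex_boundary],
    [rooms_coord_boundary], [rooms_interior]).  A room has two doors, or one
    if its edges have distinct labels, and then its new label is the last apex
    node or the last coordinate node.  Boundary doors are themselves rooms with
    distinct labels of the restrictions to one node fewer.  Counting incidences
    modulo 2 gives a recursion in a and b ([rainbow_step]); summed over all
    a < n and b < d it telescopes to the statement that the number of faces that
    carry all the apex labels and the first b coordinate labels, over all b, plus
    the number of those that carry all the coordinate labels and the first a apex
    labels, over all a, is odd ([rainbow_parity]). *)

(** * Edge weights and their marginals *)

(** A path can always be extended backwards, since its first vertex has a
    neighbour other than the second one; by finiteness some extension meets the
    path again, and it does so beyond the second vertex. *)
Lemma exists_long_cycle (W : finType) (e : rel W) :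
  symmetric e -> irreflexive e ->
  (forall u v, e u v -> exists2 w, w != u & e v w) ->
  forall u v, e u v -> exists2 c, uniq c & cycle e c /\ (2 < size c)%N.
Proof.
move=> esym eirr ebr u v euv.
suff step k : (exists2 c, uniq c & cycle e c /\ (2 < size c)%N) \/
    exists x y p, [/\ uniq [:: x, y & p], path e x (y :: p) & size p = k].
  case: (step #|W|) => // -[x [y [p [Up _ sz]]]].
  by have := uniq_leq_size Up (fun z _ => mem_enum W z);
    rewrite -cardE /= sz ltnNge leqnSn.
elim: k => [|k [|[x [y [p [Up Pp sz]]]]]]; last 2 first.
- by left.
- have /andP[exy Py] := Pp.
  have [w wy exw] : exists2 w, w != y & e x w by apply: (ebr y x); rewrite esym.
  have wx : w != x by apply: contraTneq exw => ->; rewrite eirr.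
  have [wp|wp] := boolP (w \in p); last first.
    right; exists w, x, (y :: p); split; last by rewrite /= sz.
      by rewrite cons_uniq Up !inE (negPf wx) (negPf wy) (negPf wp).
    by rewrite /= esym exw.
  left; case/splitPr: wp Up Pp {Py sz} => p1 p2 Up Pp.
  exists [:: x, y & rcons p1 w].
    move: Up; rewrite -cat_rcons -!cat_cons cat_uniq.
    by case/andP.
  split; last by rewrite /= size_rcons.
  move: Pp; rewrite -cat_rcons -cat_cons cat_path => /andP[Pp _].
  rewrite -[cycle _ _]/(path e x (rcons (y :: rcons p1 w) x)).
  by rewrite rcons_path Pp /= last_rcons esym.
right; exists u, v, [::]; split=> //=; last by rewrite euv.
by rewrite inE andbT; apply: contraTneq euv => ->; rewrite eirr.
Qed.

Section Flow.
Variables (R : realType) (d n : nat).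
Local Notation edge := ('I_d * 'I_n)%type.
Local Notation vector := ('rV[R]_n * 'rV[R]_d)%type.
Implicit Types (p q : edge) (G H : bigraph d n) (lam mu : edge -> R).

(** The point with weights [lam] on the vertices: its two components are the
    apex marginal and the coordinate marginal of [lam].  The total weight is not
    normalised to 1, which lets weights be added and subtracted freely. *)
Definition marginals lam : vector :=
  \sum_p lam p *: edge_point R p.

Definition supported lam G := forall p, p \notin G -> lam p = 0.

Lemma supported_sum (V : lmodType R) lam G (f : edge -> V) :
  supported lam G -> \sum_(p in G) lam p *: f p = \sum_p lam p *: f p.
Proof.
by move=> s; rewrite big_mkcond; apply: eq_bigr => p _; case: ifPn => // /s ->;
   rewrite scale0r.
Qed.

Lemma marginals_apex lam j :
  (marginals lam).1 0 j = \sum_(p | p.2 == j) lam p.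
Proof.
rewrite (big_morph (fun x : vector => x.1 0 j)
  (id1 := 0) (op1 := +%R)) ?mxE //; last by move=> x y; rewrite mxE.
rewrite [RHS]big_mkcond; apply: eq_bigr => p _.
by rewrite !mxE eqxx /= eq_sym; case: eqP => _; rewrite ?mulr1 ?mulr0.
Qed.

Lemma marginals_coord lam i :
  (marginals lam).2 0 i = \sum_(p | p.1 == i) lam p.
Proof.
rewrite (big_morph (fun x : vector => x.2 0 i)
  (id1 := 0) (op1 := +%R)) ?mxE //; last by move=> x y; rewrite mxE.
rewrite [RHS]big_mkcond; apply: eq_bigr => p _.
by rewrite !mxE eqxx /= eq_sym; case: eqP => _; rewrite ?mulr1 ?mulr0.
Qed.

Lemma marginals_eq lam mu :
  (forall j, \sum_(p | p.2 == j) lam p = \sum_(p | p.2 == j) mu p) ->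
  (forall i, \sum_(p | p.1 == i) lam p = \sum_(p | p.1 == i) mu p) ->
  marginals lam = marginals mu.
Proof.
move=> ha hc; apply: injective_projections; apply/rowP => k.
  by rewrite !marginals_apex ha.
by rewrite !marginals_coord hc.
Qed.

Lemma marginalsB lam mu :
  marginals (fun p => lam p - mu p) = marginals lam - marginals mu.
Proof.
rewrite -sumrB; apply: eq_bigr => p _; exact: scalerBl.
Qed.

Lemma marginalsD lam mu :
  marginals (fun p => lam p + mu p) = marginals lam + marginals mu.
Proof.
rewrite -big_split; apply: eq_bigr => p _; exact: scalerDl.
Qed.

Lemma marginalsZ a lam :
  marginals (fun p => a * lam p) = a *: marginals lam.
Proof.
rewrite scaler_sumr; apply: eq_bigr => p _; by rewrite scalerA.
Qed.

Lemma marginals_delta p :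
  marginals (fun q => (q == p)%:R) = edge_point R p.
Proof.
rewrite /marginals (bigD1 p) //= eqxx scale1r big1 ?addr0 // => q /negPf ->.
by rewrite scale0r.
Qed.

Lemma marginals_total lam : \sum_p lam p = \sum_j (marginals lam).1 0 j.
Proof.
rewrite (eq_bigr _ (fun j _ => marginals_apex lam j)).
by rewrite (partition_big (fun p => p.2) predT).
Qed.

Lemma linear_marginals (psi : {scalar vector}) lam :
  psi (marginals lam) = \sum_p lam p * psi (edge_point R p).
Proof.
by rewrite linear_sum; apply: eq_bigr => p _; rewrite linearZ.
Qed.

Lemma supported_weaken lam G H : G \subset H -> supported lam G -> supported lam H.
Proof. by move=> /subsetP sGH s p pH; apply: s; apply: contra pH => /sGH. Qed.

Lemma conv_graphP G x : conv_graph R G x <->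
  exists2 lam, (forall p, 0 <= lam p) /\ supported lam G &
    \sum_p lam p = 1 /\ x = marginals lam.
Proof.
split=> [[lam [l0 l1 ->]]|[lam [l0 s] [l1 ->]]].
  exists (fun p => if p \in G then lam p else 0); split.
  - by move=> p; case: ifPn => // /l0.
  - by move=> p /negPf ->.
  - by rewrite -l1 [RHS]big_mkcond.
  rewrite big_mkcond; apply: eq_bigr => p _.
  by case: ifP; rewrite ?scale0r.
exists lam; split=> //; last by rewrite supported_sum.
by rewrite -l1 [LHS]big_mkcond; apply: eq_bigr => p _; case: ifPn => // /s ->.
Qed.

Lemma sum0_partner (P : pred edge) lam p : P p -> lam p != 0 ->
  \sum_(q | P q) lam q = 0 -> exists2 q, P q & q != p /\ lam q != 0.
Proof.
move=> Pp lp s0; have [/existsP[q /and3P[? ? ?]]|] :=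
  boolP [exists q, [&& P q, q != p & lam q != 0]]; first by exists q.
rewrite negb_exists => /forallP h; case/eqP: lp; rewrite -s0 (bigD1 p) //=.
by rewrite big1 ?addr0 // => q /andP[Pq qp]; have := h q;
  rewrite Pq qp /= negbK => /eqP.
Qed.

(** Where the marginals vanish, an edge of nonzero weight cannot be the only one
    at either of its ends, so the support has no leaf and contains a cycle. *)
Lemma forest_independent G lam :
  forest G -> supported lam G -> marginals lam = 0 -> forall p, lam p = 0.
Proof.
move=> fG sG b0 [i j]; apply/eqP; apply: contraT => lp.
pose S : bigraph d n := [set p | lam p != 0].
have SG : S \subset G.
  by apply/subsetP => p; rewrite inE; apply: contraR => /sG ->.
have adjC : symmetric (adjacent S) by case=> ? [].
have eirr : irreflexive (adjacent S) by case.
have part (x : vector) : x = 0 ->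
    (forall k, x.1 0 k = 0) /\ (forall k, x.2 0 k = 0).
  by move=> ->; split=> k; rewrite mxE.
have [bA bC] := part _ b0.
have ebr u v : adjacent S u v -> exists2 w, w != u & adjacent S v w.
  case: u v => [i1|j1] [i2|j2] //=; rewrite inE => l.
    have [[i' j'] /eqP /= e [ne l']] :=
      sum0_partner (p := (i1, j2)) (P := fun p => p.2 == j2)
        (eqxx _) l (etrans (esym (marginals_apex _ _)) (bA j2)).
    subst j'; exists (inl i'); last by rewrite /= inE.
    by apply: contra ne => /eqP[->].
  have [[i' j'] /eqP /= e [ne l']] :=
    sum0_partner (p := (i2, j1)) (P := fun p => p.1 == i2)
      (eqxx _) l (etrans (esym (marginals_coord _ _)) (bC i2)).
  subst i'; exists (inr j'); last by rewrite /= inE.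
  by apply: contra ne => /eqP[->].
have Sij : adjacent S (inl i) (inr j) by rewrite /= inE.
have [c Uc [Cc]] := exists_long_cycle adjC eirr ebr Sij.
rewrite ltnNge => /negP[]; apply: fG => //.
case: c Cc {Uc} => //= x s; apply: sub_path => -[i1|j1] [i2|j2] //=;
exact: (subsetP SG).
Qed.

End Flow.

(** * Transport plans on covectors *)

Section Compatibility.
Variables (R : realType) (d n : nat) (T : {set bigraph d n}).
Variable Sigma : 'M[sign]_(n, d).
Hypotheses (stmT : signed_tropical_matroid R T Sigma) (fullT : full T).
Hypothesis genT : generic T.
Local Notation edge := ('I_d * 'I_n)%type.
Implicit Types (p q : edge) (G H : bigraph d n) (lam mu : edge -> R).

(** The vertices of the product of simplices are in convex position: a plan
    whose marginals are both concentrated at one node sits on one edge. *)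
Lemma conv_graph_vertex p H : conv_graph R H (edge_point R p) -> p \in H.
Proof.
move=> /conv_graphP[mu [mu0 sH] [mu1 emu]].
have [q mq] : exists q, mu q != 0.
  apply/existsP; apply: contraT; rewrite negb_exists => /forallP h.
  by case/eqP: (oner_neq0 R); rewrite -mu1 big1 // => q _; apply/eqP;
     rewrite -[_ == _]negbK h.
have mq0 : 0 < mu q by rewrite lt_def mq mu0.
have leP (P : pred edge) : P q -> mu q <= \sum_(r | P r) mu r.
  by move=> Pq; rewrite (bigD1 q) //= lerDl sumr_ge0.
suff -> : p = q by apply: contraNT mq => /sH ->.
apply/eqP; rewrite -pair_eqE; apply/andP; split.
  have := leP (fun r => r.1 == q.1) (eqxx _).
  rewrite -marginals_coord -emu !mxE /= eq_sym.
  by case: eqP => // _ /(lt_le_trans mq0); rewrite ltxx.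
have := leP (fun r => r.2 == q.2) (eqxx _).
rewrite -marginals_apex -emu !mxE /= eq_sym.
by case: eqP => // _ /(lt_le_trans mq0); rewrite ltxx.
Qed.

(** The two polytopes meet in a face of [conv G].  A face that contains a point
    contains all the vertices that have positive weight in this point. *)
Lemma supported_in_other G H lam mu : G \in T -> H \in T ->
  (forall p, 0 <= lam p) -> (forall p, 0 <= mu p) ->
  supported lam G -> supported mu H ->
  marginals lam = marginals mu -> \sum_p lam p = 1 -> supported lam H.
Proof.
move=> GT HT l0 m0 sG sH e l1.
have m1 : \sum_p mu p = 1 by rewrite marginals_total -e -marginals_total.
have cG : conv_graph R G (marginals lam) by apply/conv_graphP; exists lam.
have cH : conv_graph R H (marginals lam).
  by apply/conv_graphP; exists mu => //; split.
have [<-//|/eqP GH] := eqVneq G H.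
case: (stm_inter stmT GT HT GH) => [/(congr1 (@^~ (marginals lam)))|].
  by move=> h; have : False by rewrite -[False]h; split.
case=> -[phi [b [le eqb]]] _ p pH; apply/eqP; apply: contraNT pH => lp.
have pG : p \in G by apply: contraNT lp => /sG ->.
suff : phi (edge_point R p) = b.
  move=> hb; apply: conv_graph_vertex.
  have /eqb[] // : conv_graph R G (edge_point R p) /\ phi (edge_point R p) = b.
  split=> //; apply/conv_graphP; exists (fun q => (q == p)%:R).
    split=> q; first by rewrite ler0n.
    by case: eqP => // ->; rewrite pG.
  split; last by rewrite marginals_delta.
  by rewrite (bigD1 p) //= eqxx big1 ?addr0 // => q /negPf ->.
have /eqb[_ hb] : (conv_graph R G `&` conv_graph R H)%classic (marginals lam).
  by [].
have leq q : lam q * phi (edge_point R q) <= lam q * b.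
  have [qG|/sG ->] := boolP (q \in G); last by rewrite !mul0r.
  apply: ler_wpM2l => //; apply: le; apply/conv_graphP.
  exists (fun r => (r == q)%:R).
    split=> r; first by rewrite ler0n.
    by case: eqP => // ->; rewrite qG.
  split; last by rewrite marginals_delta.
  by rewrite (bigD1 q) //= eqxx big1 ?addr0 // => r /negPf ->.
(* An average of values at most b is equal to b only if all values of positive
   weight are. *)
have z : \sum_q (lam q * b - lam q * phi (edge_point R q)) = 0.
  by rewrite sumrB -mulr_suml l1 mul1r -linear_marginals hb subrr.
have /allP/(_ p) := etrans
  (esym (psumr_eq0 _ (fun q _ => etrans (subr_ge0 _ _) (leq q)))) (introT eqP z).
rewrite mem_index_enum -mulrBr mulf_eq0 (negPf lp) subr_eq0 /=.
by move=> /(_ isT)/eqP.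
Qed.

Lemma flow_unique G H lam mu : G \in T -> H \in T ->
  (forall p, 0 <= lam p) -> (forall p, 0 <= mu p) ->
  supported lam G -> supported mu H ->
  marginals lam = marginals mu -> forall p, lam p = mu p.
Proof.
move=> GT HT l0 m0 sG sH e p.
have em : \sum_p lam p = \sum_p mu p by rewrite !marginals_total e.
have [t0|t0] := eqVneq (\sum_p lam p) 0.
  have z (nu : edge -> R) : (forall p, 0 <= nu p) -> \sum_p nu p = 0 -> nu p = 0.
    by move=> n0 /(psumr_eq0P (fun q _ => n0 q)) ->.
  by rewrite !z -?em.
pose t := (\sum_p lam p)^-1.
have tg : 0 <= t by rewrite invr_ge0 sumr_ge0.
have sl : supported lam H.
  have h : supported (fun p => t * lam p) H.
    apply: (@supported_in_other G H _ (fun p => t * mu p)) => // [q|q|q /sG ->|q /sH ->||].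
    - exact: mulr_ge0.
    - exact: mulr_ge0.
    - by rewrite mulr0.
    - by rewrite mulr0.
    - by rewrite !marginalsZ e.
    - by rewrite -mulr_sumr mulVf.
  by move=> q /h /eqP; rewrite mulf_eq0 invr_eq0 (negPf t0) => /eqP.
apply/eqP; rewrite -subr_eq0; apply/eqP.
apply: (@forest_independent _ _ _ H (fun p => lam p - mu p)) => //.
- exact: genT.
- by move=> q qH; rewrite sl // sH // subrr.
- by rewrite marginalsB e subrr.
Qed.

Lemma flow_cover lam : (forall p, 0 <= lam p) -> (exists p, lam p != 0) ->
  exists2 H, H \in T & exists2 mu, (forall p, 0 <= mu p) /\ supported mu H &
    marginals mu = marginals lam.
Proof.
move=> l0 [p lp].
have t0 : 0 < \sum_p lam p.
  by rewrite (bigD1 p) //= ltr_pwDl ?sumr_ge0 // lt_def lp l0.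
pose t := (\sum_p lam p)^-1.
have [|H HT /conv_graphP[mu [m0 sH] [_ emu]]] :=
  stm_cover stmT (x := t *: marginals lam).
  apply/conv_graphP; exists (fun p => t * lam p).
    split=> [q|q]; first by rewrite mulr_ge0 // invr_ge0 ltW.
    by case: q => i j; rewrite fullT.
  by rewrite marginalsZ -mulr_sumr mulVf ?gt_eqF.
exists H => //; exists (fun p => t^-1 * mu p).
  split=> [q|q /sH ->]; last by rewrite mulr0.
  by rewrite mulr_ge0 // invrK ltW.
by rewrite marginalsZ -emu scalerA mulVf ?scale1r // invr_eq0 gt_eqF.
Qed.

End Compatibility.

(** * Faces contained in an initial grid *)

Lemma frequent_value (X : finType) (A : {set X}) (P : nat -> X -> Prop) :
  (forall k, exists2 x, x \in A & P k x) ->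
  exists2 x, x \in A & forall m, exists2 k, (m <= k)%N & P k x.
Proof.
move=> h; apply: contrapT => hn.
have hb x : exists m, x \in A -> forall k, (m <= k)%N -> ~ P k x.
  have [xA|//] := boolP (x \in A); last by exists 0%N.
  apply: contrapT => hx; apply: hn; exists x => // m.
  apply: contrapT => hm; apply: hx; exists m => _ k mk Pk; apply: hm.
  by exists k.
have [m hm] := boolp.choice hb.
have [x xA] := h (\max_x m x)%N; apply: hm => //.
exact: (leq_bigmax x).
Qed.

Lemma size_ord_range m l k :
  (size [seq i : 'I_m <- enum 'I_m | l <= i < l + k] <= k)%N.
Proof.
rewrite -[X in (_ <= X)%N](size_iota l k) -(size_map val).
apply: uniq_leq_size => [|i].
  by rewrite (map_inj_uniq val_inj) filter_uniq ?enum_uniq.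
by case/mapP => j; rewrite mem_filter mem_iota => /andP[? _] ->.
Qed.

Section Complex.
Variables (R : realType) (d n : nat).
Local Notation edge := ('I_d * 'I_n)%type.
Local Notation vector := ('rV[R]_n * 'rV[R]_d)%type.
Implicit Types (p q r : edge) (M N G H : bigraph d n) (lam mu psi : edge -> R).

(** What the count needs of the complex of all faces, boundary faces with
    isolated apex nodes included. *)
Record flow_triangulation (K : {set bigraph d n}) : Prop := {
  triangulation_sub : forall M N, N \in K -> M \subset N -> M \in K;
  triangulation_unique : forall G H lam mu, G \in K -> H \in K ->
    (forall p, 0 <= lam p) -> (forall p, 0 <= mu p) ->
    supported lam G -> supported mu H ->
    marginals lam = marginals mu -> forall p, lam p = mu p;
  triangulation_cover : forall lam, (forall p, 0 <= lam p) ->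
    (exists p, lam p != 0) ->
    exists2 H, H \in K & exists2 mu, (forall p, 0 <= mu p) /\ supported mu H &
      marginals mu = marginals lam
}.

(** Edge weights induced by a linear functional of the marginals.  A balanced
    weight that vanishes on a codimension one face describes its hyperplane and
    tells apart the two sides of the face. *)
Definition balanced psi := forall lam mu, marginals lam = marginals mu ->
  \sum_p lam p * psi p = \sum_p mu p * psi p.

Definition grid a b : bigraph d n := [set p : edge | (p.1 < b)%N && (p.2 < a)%N].

Lemma gridE a b p : (p \in grid a b) = (p.1 < b)%N && (p.2 < a)%N.
Proof. by rewrite inE. Qed.

Lemma grid_supported a b lam mu : (forall p, 0 <= mu p) ->
  marginals mu = marginals lam -> supported lam (grid a b) ->
  supported mu (grid a b).
Proof.
move=> m0 e sl p; rewrite gridE negb_and.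
suff z (P : pred edge) : P p -> (forall q, P q -> q \notin grid a b) ->
    \sum_(q | P q) mu q = \sum_(q | P q) lam q -> mu p = 0.
  case/orP => out.
    apply: (z (fun q => q.1 == p.1)) => [//|q /eqP eq|].
      by rewrite gridE eq (negPf out).
    by rewrite -!marginals_coord e.
  apply: (z (fun q => q.2 == p.2)) => [//|q /eqP eq|].
    by rewrite gridE eq (negPf out) andbF.
  by rewrite -!marginals_apex e.
move=> Pp out; rewrite [RHS]big1 => [|q /out/sl//].
by move=> /(psumr_eq0P (fun q _ => m0 q)) ->.
Qed.

Definition edge_points N : #|N|.-tuple vector :=
  [tuple edge_point R (enum_val i) | i < #|N|].

Lemma edge_points_flow N (k : 'I_#|N| -> R) : exists lam,
  [/\ supported lam N, marginals lam = \sum_i k i *: (edge_points N)`_i &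
      forall i, lam (enum_val i) = k i].
Proof.
exists (fun p => \sum_(i | enum_val i == p) k i); split.
- by move=> p pN; rewrite big1 // => i /eqP ip; rewrite -ip enum_valP in pN.
- rewrite /marginals.
  under eq_bigr do rewrite scaler_suml.
  rewrite (exchange_big_dep predT) //=; apply: eq_bigr => i _.
  by rewrite (big_pred1 (enum_val i)) ?nth_mktuple // => p; rewrite /= eq_sym.
- move=> i; rewrite (big_pred1 i) // => j.
  by rewrite (inj_eq enum_val_inj).
Qed.

Lemma balanced_scalar (f : {scalar vector}) :
  balanced (fun p => f (edge_point R p)).
Proof. by move=> lam mu e; rewrite -!linear_marginals e. Qed.

Lemma balancedN psi : balanced psi -> balanced (fun p => - psi p).
Proof.
move=> bp lam mu /bp e.
by under eq_bigr do rewrite mulrN; under [RHS]eq_bigr do rewrite mulrN;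
   rewrite !sumrN e.
Qed.

Lemma balanced_apex j : balanced (fun p => (p.2 == j)%:R).
Proof.
move=> lam mu e.
have E nu : \sum_p nu p * ((p.2 == j)%:R : R) = \sum_(p | p.2 == j) nu p.
  by rewrite [RHS]big_mkcond; apply: eq_bigr => p _; case: eqP;
    rewrite ?mulr1 ?mulr0.
by rewrite !E -!marginals_apex e.
Qed.

Lemma balanced_coord i : balanced (fun p => (p.1 == i)%:R).
Proof.
move=> lam mu e.
have E nu : \sum_p nu p * ((p.1 == i)%:R : R) = \sum_(p | p.1 == i) nu p.
  by rewrite [RHS]big_mkcond; apply: eq_bigr => p _; case: eqP;
    rewrite ?mulr1 ?mulr0.
by rewrite !E -!marginals_coord e.
Qed.

Variable K : {set bigraph d n}.
Hypothesis triK : flow_triangulation K.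

(** Split a signed weight into the nonnegative weights |lam| + lam and
    |lam| - lam, which have the same marginals. *)
Lemma face_independent N lam : N \in K -> supported lam N ->
  marginals lam = 0 -> forall p, lam p = 0.
Proof.
move=> NK sN b0 p.
have : `|lam p| + lam p = `|lam p| - lam p.
  apply: (triangulation_unique triK (G := N) (H := N)
    (lam := fun p => `|lam p| + lam p) (mu := fun p => `|lam p| - lam p)) => //.
  - by move=> q; rewrite -lerBlDr sub0r -normrN ler_norm.
  - by move=> q; rewrite subr_ge0 ler_norm.
  - by move=> q /sN ->; rewrite normr0 addr0.
  - by move=> q /sN ->; rewrite normr0 subr0.
  - by rewrite marginalsD marginalsB b0 addr0 subr0.
move/addrI/eqP; rewrite -subr_eq0 opprK -mulr2n mulrn_eq0 /= => /eqP //.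
Qed.

Lemma free_edge_points N : N \in K -> free (edge_points N).
Proof.
move=> NK; apply/freeP => k k0 i.
have [lam [sl bl <-]] := edge_points_flow k.
by apply: (face_independent NK) => //; rewrite bl k0.
Qed.

(** The coordinate at [p] in the basis formed by the vertices of [N]. *)
Lemma face_dual N p : N \in K -> p \in N ->
  exists2 psi, balanced psi & psi p = 1 /\ forall q, q \in N -> q != p -> psi q = 0.
Proof.
move=> NK pN; pose k := enum_rank_in pN p.
have e q : q \in N -> edge_point R q = (edge_points N)`_(enum_rank_in pN q).
  by move=> qN; rewrite nth_mktuple enum_rankK_in.
exists (fun q => coord (edge_points N) k (edge_point R q)).
  exact: balanced_scalar.
split; first by rewrite e // coord_free ?free_edge_points // eqxx.
move=> q qN qp; rewrite e // coord_free ?free_edge_points //.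
suff /negPf -> : enum_rank_in pN q != k by [].
apply: contra qp => /eqP/(congr1 enum_val).
by rewrite !enum_rankK_in // => ->.
Qed.

Section Span.
Variables (a b : nat) (a_lt : (a < n)%N) (b_lt : (b < d)%N).

Let i0 : 'I_d := Ordinal (leq_ltn_trans (leq0n b) b_lt).
Let j0 : 'I_n := Ordinal (leq_ltn_trans (leq0n a) a_lt).

(* A double star at the nodes i0 and j0; the second list leaves out the edge
   (i0, j0) that the first one already has. *)
Let star : seq vector :=
  [seq edge_point R (i, j0) | i <- [seq i : 'I_d <- enum 'I_d | (0 <= i < 0 + b.+1)%N]] ++
  [seq edge_point R (i0, j) | j <- [seq j : 'I_n <- enum 'I_n | (1 <= j < 1 + a)%N]].

Lemma edge_point_exchange (i i' : 'I_d) (j j' : 'I_n) :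
  edge_point R (i, j) =
  edge_point R (i, j') + edge_point R (i', j) - edge_point R (i', j').
Proof.
apply: injective_projections => /=; first by rewrite addrAC subrr add0r.
by rewrite addrK.
Qed.

Let grid_star p : p \in grid a.+1 b.+1 -> edge_point R p \in <<star>>%VS.
Proof.
case: p => i j; rewrite gridE /= => /andP[ib ja].
have c (i1 : 'I_d) : (i1 < b.+1)%N -> edge_point R (i1, j0) \in <<star>>%VS.
  move=> h; apply: memv_span; rewrite mem_cat; apply/orP; left.
  by apply/mapP; exists i1 => //; rewrite mem_filter mem_enum h.
have [jz|jz] := eqVneq j j0; first by rewrite jz; exact: c.
rewrite (edge_point_exchange i i0 j j0) rpredB ?rpredD ?c //.
apply: memv_span; rewrite mem_cat; apply/orP; right.
apply/mapP; exists j => //; rewrite mem_filter mem_enum andbT add1n ja andbT.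
by rewrite lt0n; apply: contra jz => /eqP h; apply/eqP/val_inj.
Qed.

Let dim_star : (\dim <<star>> <= (a + b).+1)%N.
Proof.
apply: leq_trans (dim_span _) _; rewrite size_cat !size_map addnC -addnS.
by apply: leq_add; apply: size_ord_range.
Qed.

Let span_edge_points_sub N : N \subset grid a.+1 b.+1 ->
  (<<edge_points N>> <= <<star>>)%VS.
Proof.
move=> /subsetP sN; apply/span_subvP => v /mapP[i _ ->].
by apply/grid_star/sN/enum_valP.
Qed.

Lemma face_card N : N \in K -> N \subset grid a.+1 b.+1 -> (#|N| <= (a + b).+1)%N.
Proof.
move=> NK sN; have := free_edge_points NK; rewrite /free size_tuple => /eqP <-.
exact: leq_trans (dimvS (span_edge_points_sub sN)) dim_star.
Qed.

(** A face of maximal size is a basis of the span of the grid, because the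
    double star generates this span with no more than [(a + b).+1] vectors. *)
Lemma face_basis N q : N \in K -> N \subset grid a.+1 b.+1 ->
  #|N| = (a + b).+1 -> q \in grid a.+1 b.+1 ->
  exists2 lam, supported lam N & marginals lam = edge_point R q.
Proof.
move=> NK sN cN qg.
have eqs : (<<edge_points N>> == <<star>>)%VS.
  rewrite eqEdim span_edge_points_sub //=; apply: leq_trans dim_star _.
  by have := free_edge_points NK; rewrite /free size_tuple => /eqP ->; rewrite cN.
have [lam [sl bl _]] :=
  edge_points_flow (fun i => coord (edge_points N) i (edge_point R q)).
exists lam; rewrite // bl -coord_span // (eqP eqs); exact: grid_star.
Qed.

End Span.

(** Move from the interior of the face [M] towards the vertex [q], on the side
    where [psi] is positive.  The points k * M + q, for large k, are the rescaled
    positions after shorter and shorter moves.  One face [H] covers infinitely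
    many of them, so it contains [M]; since it also covers a point with [psi]
    positive, it has a vertex of this kind. *)
Lemma extend_face a b M q psi : M \in K -> M \subset grid a b ->
  q \in grid a b -> balanced psi -> (forall p, p \in M -> psi p = 0) ->
  0 < psi q ->
  exists p, [/\ p \in grid a b, 0 < psi p & p |: M \in K].
Proof.
move=> MK Mg qg bal psiM psiq.
pose f k p : R := k%:R * (p \in M)%:R + (p == q)%:R.
have f0 k p : 0 <= f k p by rewrite addr_ge0 ?mulr_ge0 ?ler0n.
have fg k : supported (f k) (grid a b).
  move=> p pg; rewrite /f; have -> : p \in M = false.
    by apply: contraNF pg; apply: (subsetP Mg).
  by case: eqP => [pq|_]; [rewrite pq qg in pg | rewrite mulr0 addr0].
have bf k : marginals (f k) = k%:R *: marginals (fun p => (p \in M)%:R) + edge_point R q.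
  by rewrite marginalsD marginalsZ marginals_delta.
pose P k H := exists2 mu, (forall p, 0 <= mu p) /\ supported mu H &
    marginals mu = marginals (f k).
have [k|H HK freqH] := @frequent_value _ K P.
  apply: (triangulation_cover triK (f0 k)); exists q.
  by rewrite gt_eqF // ltr_wpDl ?mulr_ge0 // /f ?eqxx ?ltr01 ?ler0n.
have [k1 _ [mu1 [m10 s1] b1]] := freqH 0%N.
have [k2 k12 [mu2 [_ s2] b2]] := freqH k1.+1.
pose c : R := (k2%:R - k1%:R)^-1.
have c0 : k2%:R - k1%:R != 0 :> R by rewrite subr_eq0 eqr_nat gtn_eqF.
pose D p := c * (mu2 p - mu1 p).
have sD : supported D H by move=> p pH; rewrite /D s1 // s2 // subrr mulr0.
have bD : marginals D = marginals (fun p => (p \in M)%:R).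
  rewrite marginalsZ marginalsB b1 b2 !bf opprD addrACA subrr addr0.
  by rewrite -scalerBl scalerA mulVf ?scale1r.
(* The plan at time k is [mu1] plus k - k1 times [D], which is nonnegative for
   arbitrarily large k. *)
have D0 p : 0 <= D p.
  rewrite leNgt; apply/negP => Dp.
  have [k kb [mu [m0 s] bm]] := freqH (k1 + Num.bound (mu1 p / - D p))%N.
  have e : mu p - (mu1 p + (k%:R - k1%:R) * D p) = 0.
    apply: (@face_independent H (fun p => mu p - (mu1 p + (k%:R - k1%:R) * D p))) => //.
      by move=> r rH; rewrite s // s1 // sD // mulr0 addr0 subrr.
    rewrite marginalsB marginalsD marginalsZ bD bm b1 !bf.
    have cancel (x y z : vector) : x + z - (y + z + (x - y)) = 0.
      by rewrite [y + z + _]addrAC [y + _]addrC subrK subrr.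
    by rewrite scalerBl cancel.
  have := m0 p; move/eqP: e; rewrite subr_eq0 => /eqP ->.
  apply/negP; rewrite -ltNge -ltrBrDl sub0r -ltrN2 opprK -mulrN.
  rewrite -ltr_pdivrMr ?oppr_gt0 //.
  have /archi_boundP/lt_le_trans : 0 <= mu1 p / - D p.
    by rewrite divr_ge0 // oppr_ge0 ltW.
  by apply; rewrite lerBrDl -natrD ler_nat.
have MH : M \subset H.
  apply/subsetP => p pM; apply: contraT => /sD.
  have -> := triangulation_unique triK (mu := fun p => (p \in M)%:R) HK MK D0 _ sD _ bD.
  - by rewrite pM => /eqP; rewrite oner_eq0.
  - by move=> r; rewrite ler0n.
  - by move=> r /negPf ->.
have g1 : supported mu1 (grid a b) by apply: (grid_supported m10 b1).
have : 0 < \sum_p mu1 p * psi p.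
  rewrite (bal _ _ b1) (bigD1 q) //= big1 => [|r rq].
    rewrite addr0 /f eqxx mulr_gt0 // ltr_wpDl ?mulr_ge0 ?ler0n ?ltr01 //.
  rewrite /f (negPf rq) addr0.
  by have [/psiM->|_] := boolP (r \in M); rewrite !(mulr0, mul0r).
move=> pos; have [p pp] : exists p, 0 < mu1 p * psi p.
  apply/existsP; apply: contraLR pos; rewrite negb_exists -leNgt => /forallP h.
  by apply: sumr_le0 => p _; rewrite leNgt; apply: h.
have mp : mu1 p != 0 by apply: contraTneq pp => ->; rewrite mul0r ltxx.
exists p; split.
- by apply: contraNT mp => /g1 ->.
- by move: pp; rewrite pmulr_rgt0 // lt_def mp m10.
apply: (triangulation_sub triK HK); rewrite subUset MH sub1set andbT.
by apply: contraNT mp => /s1 ->.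
Qed.

Section Rooms.
Variables (a b : nat) (a_lt : (a < n)%N) (b_lt : (b < d)%N).
Variable M : bigraph d n.
Hypotheses (MK : M \in K) (Mg : M \subset grid a.+1 b.+1).
Hypothesis (cardM : #|M| = (a + b)%N).

Definition rooms : {set bigraph d n} :=
  [set N in K | [&& N \subset grid a.+1 b.+1, M \subset N & #|N| == (a + b).+1]].

Lemma room_edge N : N \in rooms ->
  exists p, [/\ N = p |: M, p \notin M & p \in grid a.+1 b.+1].
Proof.
rewrite inE => /and4P[NK sN MN cN].
have : #|N :\: M| == 1%N by rewrite cardsD (setIidPr MN) (eqP cN) cardM subSnn.
case/cards1P => p ep; have pN : p \in N :\: M by rewrite ep set11.
exists p; move: pN; rewrite inE => /andP[pM pN]; split=> //.
  by rewrite -[LHS](finset.setID N M) ep (finset.setIidPr MN) finset.setUC.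
exact: (subsetP sN).
Qed.

Lemma edge_room p : p \in grid a.+1 b.+1 -> p \notin M -> p |: M \in K ->
  p |: M \in rooms.
Proof.
by move=> pg pM pK; rewrite inE pK subUset sub1set pg Mg subsetUr cardsU1 pM cardM eqxx.
Qed.

Variable psi : edge -> R.
Hypotheses (bal : balanced psi) (psiM : forall p, p \in M -> psi p = 0).

(** The vertex [q] is a combination of [p |: M] with a positive coefficient at
    [p]; adding a large multiple of [M] makes all coefficients nonnegative, and
    gives two plans with equal marginals on the two faces. *)
Lemma same_side_eq p q : p |: M \in K -> q |: M \in K ->
  p \in grid a.+1 b.+1 -> q \in grid a.+1 b.+1 ->
  0 < psi p -> 0 < psi q -> p = q.
Proof.
move=> pK qK pg qg pp pq.
have out r : 0 < psi r -> r \notin M by apply: contraTN => /psiM ->; rewrite ltxx.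
have cp : #|p |: M| = (a + b).+1 by rewrite cardsU1 out // cardM.
have sp : p |: M \subset grid a.+1 b.+1 by rewrite subUset sub1set pg.
have [al sal bal_q] := face_basis a_lt b_lt pK sp cp qg.
have alp : 0 < al p.
  have : psi q = al p * psi p.
    have := bal (etrans bal_q (esym (marginals_delta R q))).
    rewrite (bigD1 p) //= big1 => [|r rp].
      rewrite addr0 => ->; rewrite (bigD1 q) //= eqxx mul1r big1 ?addr0 //.
      by move=> r /negPf ->; rewrite mul0r.
    have [/psiM->|rM] := boolP (r \in M); first by rewrite mulr0.
    by rewrite sal ?mul0r // !inE negb_or rp rM.
  by move=> e; rewrite e pmulr_lgt0 in pq.
pose C := \sum_r `|al r|.
have C0 : 0 <= C by apply: sumr_ge0.
apply/eqP; apply: contraT => pnq.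
have : al q + C * (q \in M)%:R = (q == q)%:R + C * (q \in M)%:R.
  apply: (triangulation_unique triK (G := p |: M) (H := q |: M)
    (lam := fun r => al r + C * (r \in M)%:R)
    (mu := fun r => (r == q)%:R + C * (r \in M)%:R)) => //.
  - move=> r; have [rM|rM] := boolP (r \in M).
      rewrite mulr1 -lerBlDl sub0r; apply: le_trans (ler_norm _) _.
      by rewrite normrN /C (bigD1 r) //= lerDl sumr_ge0.
    rewrite mulr0 addr0; have [->|rp] := eqVneq r p; first exact: ltW.
    by rewrite sal // !inE negb_or rp rM.
  - by move=> r; rewrite addr_ge0 ?mulr_ge0 ?ler0n.
  - move=> r rp; rewrite sal //; move: rp; rewrite !inE negb_or => /andP[_ /negPf->].
    by rewrite mulr0 addr0.
  - by move=> r; rewrite !inE negb_or => /andP[/negPf-> /negPf->]; rewrite mulr0 addr0.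
  - by rewrite !marginalsD bal_q marginals_delta.
rewrite (negPf (out _ pq)) mulr0 !addr0 eqxx sal => [/eqP|].
  by rewrite eq_sym oner_eq0.
by rewrite !inE negb_or eq_sym pnq out.
Qed.

Lemma positive_side q : q \in grid a.+1 b.+1 -> 0 < psi q ->
  exists p, [/\ p \in grid a.+1 b.+1, 0 < psi p, p |: M \in rooms &
    forall r, r \in grid a.+1 b.+1 -> r |: M \in rooms -> 0 < psi r -> r = p].
Proof.
move=> qg pq; have [p [pg pp pK]] := extend_face MK Mg qg bal psiM pq.
have pM : p \notin M by apply: contraTN pp => /psiM ->; rewrite ltxx.
exists p; split=> // [|r rg]; first exact: edge_room.
by rewrite inE => /and4P[rK _ _ _] pr; apply: same_side_eq.
Qed.

(** A room spans the grid, so a functional that vanishes on it is zero. *)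
Lemma room_transversal q p : q \in grid a.+1 b.+1 -> psi q != 0 ->
  p |: M \in rooms -> psi p != 0.
Proof.
move=> qg pq; rewrite inE => /and4P[pK sp _ /eqP cp].
have [al sal bal_q] := face_basis a_lt b_lt pK sp cp qg.
apply: contra pq => /eqP pp.
have := bal (etrans bal_q (esym (marginals_delta R q))).
rewrite big1 => [|r _].
  rewrite (bigD1 q) //= eqxx mul1r big1 ?addr0 => [<-//|r /negPf ->].
  by rewrite mul0r.
have [rN|/sal ->] := boolP (r \in p |: M); last by rewrite mul0r.
by move: rN; rewrite !inE => /orP[/eqP->|/psiM->]; rewrite ?pp mulr0.
Qed.

(** A face in a supporting hyperplane has neighbours on one side only. *)
Lemma rooms_halfspace q : q \in grid a.+1 b.+1 -> 0 < psi q ->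
  (forall p, 0 <= psi p) -> #|rooms| = 1%N.
Proof.
move=> qg pq p0; have [p [pg pp pr uniq_p]] := positive_side qg pq.
apply/eqP/cards1P; exists (p |: M); apply/setP => N; rewrite inE.
apply/idP/eqP => [Nr|->//].
have [r [eN rM rg]] := room_edge Nr; rewrite eN in Nr *.
rewrite (uniq_p r) // lt_def p0 andbT.
by apply: (room_transversal qg _ Nr); rewrite gt_eqF.
Qed.

End Rooms.

Lemma rooms_apex_boundary a b (a_lt : (a < n)%N) (b_lt : (b < d)%N) M :
  M \in K -> M \subset grid a b.+1 -> #|M| = (a + b)%N -> #|rooms a b M| = 1%N.
Proof.
move=> MK Mg cM.
have Mg' : M \subset grid a.+1 b.+1.
  apply: subset_trans Mg _; apply/subsetP => p; rewrite !gridE => /andP[-> /=].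
  exact: ltnW.
apply: (rooms_halfspace a_lt b_lt MK Mg' cM (balanced_apex (Ordinal a_lt))
  (q := (Ordinal b_lt, Ordinal a_lt)) _ _ _ _) => [p pM||| p].
- have := subsetP Mg _ pM; rewrite gridE => /andP[_].
  by case: eqP => // ->; rewrite ltnn.
- by rewrite gridE /= !ltnSn.
- by rewrite eqxx ltr01.
- by rewrite ler0n.
Qed.

Lemma rooms_coord_boundary a b (a_lt : (a < n)%N) (b_lt : (b < d)%N) M :
  M \in K -> M \subset grid a.+1 b -> #|M| = (a + b)%N -> #|rooms a b M| = 1%N.
Proof.
move=> MK Mg cM.
have Mg' : M \subset grid a.+1 b.+1.
  apply: subset_trans Mg _; apply/subsetP => p; rewrite !gridE => /andP[/ltnW].
  by rewrite ltnS => + ->; rewrite ltnS => ->.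
apply: (rooms_halfspace a_lt b_lt MK Mg' cM (balanced_coord (Ordinal b_lt))
  (q := (Ordinal b_lt, Ordinal a_lt)) _ _ _ _) => [p pM||| p].
- have := subsetP Mg _ pM; rewrite gridE => /andP[+ _].
  by case: eqP => // ->; rewrite ltnn.
- by rewrite gridE /= !ltnSn.
- by rewrite eqxx ltr01.
- by rewrite ler0n.
Qed.

(** If [M + (i, j)] is a room, then [M] has an edge (i', j) and an edge (i, j').
    The four vertices of the square with nodes i, i', j, j' satisfy
    (i, j) + (i', j') = (i, j') + (i', j), so (i', j') lies on the side of [M]
    opposite to (i, j), and there is a second room there. *)
Lemma rooms_interior a b (a_lt : (a < n)%N) (b_lt : (b < d)%N) M :
  M \in K -> M \subset grid a.+1 b.+1 -> #|M| = (a + b)%N ->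
  (forall j : 'I_n, (j <= a)%N -> exists i : 'I_d, (i, j) \in M) ->
  (forall i : 'I_d, (i <= b)%N -> exists j : 'I_n, (i, j) \in M) ->
  ~~ odd #|rooms a b M|.
Proof.
move=> MK Mg cM covA covC.
have [->|[N Nr]] := set_0Vmem (rooms a b M); first by rewrite cards0.
have [[i j] [eN pM pg]] := room_edge cM Nr.
have NK : N \in K by move: Nr; rewrite inE => /andP[].
have [|psi bal [psip psiN]] := @face_dual N (i, j) NK.
  by rewrite eN !inE eqxx.
have psiM q : q \in M -> psi q = 0.
  move=> qM; apply: psiN; first by rewrite eN !inE qM orbT.
  by apply: contraNneq pM => <-.
move: (pg); rewrite gridE /= !ltnS => /andP[ib ja].
have [i' i'M] := covA j ja; have [j' j'M] := covC i ib.
have qg : (i', j') \in grid a.+1 b.+1.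
  have := subsetP Mg _ i'M; have := subsetP Mg _ j'M; rewrite !gridE /=.
  by move=> /andP[_ ->] /andP[-> _].
have psiq : psi (i', j') = -1.
  pose e q r : R := (r == q)%:R.
  have se q : \sum_p e q p * psi p = psi q.
    rewrite (bigD1 q) //= /e eqxx mul1r big1 ?addr0 // => r /negPf ->.
    by rewrite mul0r.
  have := bal (fun r => e (i, j) r + e (i', j') r) (fun r => e (i, j') r + e (i', j) r).
  rewrite !marginalsD !marginals_delta (edge_point_exchange i i' j j') subrK.
  move=> /(_ erefl).
  under eq_bigr do rewrite mulrDl; under [RHS]eq_bigr do rewrite mulrDl.
  rewrite !big_split /= !se psip (psiM _ i'M) (psiM _ j'M) addr0 => /eqP.
  by rewrite addrC addr_eq0 => /eqP.
have [|p1 [p1g p1p p1r u1]] := positive_side a_lt b_lt MK Mg cM bal psiM pg.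
  by rewrite psip ltr01.
have balN := balancedN bal.
have psiMN q : q \in M -> - psi q = 0 by move=> /psiM ->; rewrite oppr0.
have [|p2 [p2g p2p p2r u2]] := positive_side a_lt b_lt MK Mg cM balN psiMN qg.
  by rewrite psiq opprK ltr01.
have p2M : p2 \notin M.
  by apply: contraTN p2p => /psiM ->; rewrite oppr0 ltxx.
suff -> : rooms a b M = [set p1 |: M; p2 |: M].
  rewrite cards2; case: eqP => // e.
  have : p2 \in p1 |: M by rewrite e !inE eqxx.
  rewrite !inE (negPf p2M) orbF => /eqP p21; move: p2p.
  by rewrite p21 oppr_gt0 ltNge (ltW p1p).
apply/setP => N'; rewrite finset.in_set2; apply/idP/orP => [N'r|[/eqP->|/eqP->]//].
have [r [eN' rM rg]] := room_edge cM N'r; rewrite eN' in N'r *.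
have r0 : psi r != 0.
  by apply: (room_transversal a_lt b_lt bal psiM pg) N'r; rewrite psip oner_eq0.
case: (ltgtP (psi r) 0) => [rn|rp|re]; last by rewrite re eqxx in r0.
  by right; rewrite (u2 r) // oppr_gt0.
by left; rewrite (u1 r).
Qed.

End Complex.
Arguments grid {d n} a b.

(** * The parity count *)

Lemma odd_sum_card (I : finType) (A : {set I}) (f : I -> nat) :
  odd (\sum_(x in A) f x)%N = odd #|[set x in A | odd (f x)]|.
Proof.
have odd_big (g : I -> nat) :
    odd (\sum_(x in A) g x)%N = \big[addb/false]_(x in A) odd (g x).
  exact: (big_morph odd oddD).
have -> : #|[set x in A | odd (f x)]| = (\sum_(x in A) odd (f x))%N.
  rewrite -sum1_card big_mkcond [RHS]big_mkcond; apply: eq_bigr => x _.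
  by rewrite inE; case: (x \in A).
by rewrite !odd_big; apply: eq_bigr => x _; rewrite oddb.
Qed.

(** If the labels of [N] are only those of [L], exactly two elements share a
    label and either may be dropped; otherwise the labels are distinct and only
    the element with the label outside [L] may be dropped. *)
Lemma odd_door_count (X Y : finType) (f : X -> Y) (N : {set X}) (L : {set Y}) :
  #|N| = #|L|.+1 -> L \subset f @: N ->
  odd #|[set e in N | f @: (N :\ e) == L]| = (f @: N != L).
Proof.
move=> cN sL.
have cD e : e \in N -> #|N :\ e| = #|L|.
  by move=> eN; have := cardsD1 e N; rewrite eN cN add1n => -[].
have [eL|nL] := eqVneq (f @: N) L.
  have [x1 x1N [x2 x2N [x12 fx]]] : exists2 x1, x1 \in N &
      exists2 x2, x2 \in N & x1 != x2 /\ f x1 = f x2.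
    apply: contrapT => h; have : {in N &, injective f}.
      move=> x1 x2 x1N x2N fx; apply/eqP; apply: contraT => x12.
      by case: h; exists x1 => //; exists x2.
    by move/card_in_imset; rewrite eL cN => /eqP; rewrite ltn_eqF.
  suff -> : [set e in N | f @: (N :\ e) == L] = [set x1; x2].
    by rewrite cards2 x12.
  have twin u v : u \in N -> v \in N -> u != v -> f u = f v -> f @: (N :\ u) == L.
    move=> uN vN uv fuv; rewrite -eL eqEsubset imsetS ?subsetDl //=.
    apply/subsetP => _ /imsetP[x xN ->].
    have [->|xu] := eqVneq x u; last by apply: imset_f; rewrite !inE xu.
    by rewrite fuv; apply: imset_f; rewrite !inE eq_sym uv.
  apply/setP => e; rewrite !inE; apply/andP/orP => [[eN /eqP fe]|[]/eqP->].
  - have /imset_injP inj : #|f @: (N :\ e)| == #|N :\ e| by rewrite fe cD.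
    have [_|ex1] := eqVneq e x1; first by left.
    have [_|ex2] := eqVneq e x2; first by right.
    by case/eqP: x12; apply: inj; rewrite // !inE eq_sym ?ex1 ?ex2 ?x1N ?x2N.
  - by split=> //; apply: (twin x1 x2).
  - by split=> //; apply: (twin x2 x1); rewrite 1?eq_sym.
have cf : #|f @: N| = #|L|.+1.
  apply/eqP; rewrite eqn_leq -[X in (_ <= X)%N]cN leq_imset_card /=.
  by rewrite proper_card // properEneq eq_sym nL.
have /cards1P[y ey] : #|f @: N :\: L| == 1%N.
  by rewrite cardsD (setIidPr sL) cf subSnn.
have : y \in f @: N :\: L by rewrite ey set11.
rewrite inE => /andP[yL /imsetP[e0 e0N ye0]].
have dropE e : e \in N -> (f @: (N :\ e) == L) = (f e == y).
  move=> eN; apply/eqP/eqP => [fe|fe].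
    apply/eqP; rewrite -in_set1 -ey inE imset_f // andbT.
    apply: contra nL => feL; rewrite eqEsubset sL andbT.
    apply/subsetP => _ /imsetP[x xN ->].
    have [->//|xe] := eqVneq x e.
    by rewrite -fe imset_f // !inE xe.
  apply/esym/eqP; rewrite eqEcard -(cD e eN) leq_imset_card andbT.
  apply/subsetP => l lL; have /imsetP[x xN lx] := subsetP sL _ lL.
  rewrite lx imset_f // !inE xN andbT.
  by apply: contraNneq yL => xe; rewrite -fe -xe -lx.
suff -> : [set e in N | f @: (N :\ e) == L] = [set e0] by rewrite cards1.
have injN : {in N &, injective f}.
  by apply/imset_injP; rewrite cN cf.
apply/setP => e; rewrite !inE; apply/andP/eqP => [[eN]|->].
  by rewrite dropE // ye0 => /eqP; apply: injN.
by split=> //; rewrite dropE // ye0.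
Qed.

Section Count.
Variables (R : realType) (d n : nat) (K : {set bigraph d n}).
Hypotheses (triK : flow_triangulation R K) (K0 : finset.set0 \in K).
Local Notation edge := ('I_d * 'I_n)%type.
Variable neg : pred edge.
Implicit Types (p q r : edge) (M N : bigraph d n).

Definition label p : 'I_n + 'I_d := if neg p then inr p.1 else inl p.2.

Definition first_labels (s t : nat) : {set 'I_n + 'I_d} :=
  [set x : 'I_n + 'I_d | match x with inl j => j < s | inr i => i < t end]%N.

(** Faces of the grid whose edges have distinct labels, namely the first [s] apex
    nodes and the first [t] coordinate nodes.  In the grid with [a.+1] and [b.+1]
    nodes, the doors are the case [(a, b)], and the rooms with a single door are
    the cases [(a.+1, b)] and [(a, b.+1)]. *)
Definition rainbow (a b s t : nat) : {set bigraph d n} :=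
  [set N in K | [&& N \subset grid a b, #|N| == s + t & label @: N == first_labels s t]]%N.

Lemma first_labelsS_apex s t (s_lt : (s < n)%N) :
  first_labels s.+1 t = inl (Ordinal s_lt) |: first_labels s t.
Proof.
apply/setP => -[j|i]; rewrite !inE //=.
by rewrite ltnS leq_eqVlt; congr (_ || _);
   apply/eqP/eqP => [h|[->]//]; congr inl; apply: val_inj.
Qed.

Lemma first_labelsS_coord s t (t_lt : (t < d)%N) :
  first_labels s t.+1 = inr (Ordinal t_lt) |: first_labels s t.
Proof.
apply/setP => -[j|i]; rewrite !inE //=.
by rewrite ltnS leq_eqVlt; congr (_ || _);
   apply/eqP/eqP => [h|[->]//]; congr inr; apply: val_inj.
Qed.

Lemma card_first_labels s t : (s <= n)%N -> (t <= d)%N -> #|first_labels s t| = (s + t)%N.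
Proof.
elim: s => [|s IHs] sn td; last first.
  rewrite (first_labelsS_apex t sn) cardsU1 IHs ?(ltnW sn) //.
  by have -> : (inl (Ordinal sn) \in first_labels s t) = false by rewrite inE ltnn.
elim: t td => [|t IHt] td; last first.
  rewrite (first_labelsS_coord 0 td) cardsU1 IHt ?(ltnW td) //.
  by have -> : (inr (Ordinal td) \in first_labels 0 t) = false by rewrite inE ltnn.
by apply/eqP; rewrite cards_eq0; apply/eqP/setP => -[]; move=> ?; rewrite !inE.
Qed.

Lemma label_grid a b p : p \in grid a b -> label p \in first_labels a b.
Proof. by rewrite gridE inE /label => /andP[pb pa]; case: (neg p). Qed.

Section Step.
Variables (a b : nat) (a_lt : (a < n)%N) (b_lt : (b < d)%N).

Let full_rooms : {set bigraph d n} :=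
  [set N in K | [&& N \subset grid a.+1 b.+1, #|N| == (a + b).+1 &
                    first_labels a b \subset label @: N]].
Let doors := rainbow a.+1 b.+1 a b.

Let card_first_ab : #|first_labels a b| = (a + b)%N.
Proof. by rewrite card_first_labels // ltnW. Qed.

Let room_parity N : N \in full_rooms ->
  odd #|[set M in doors | M \subset N]| = (label @: N != first_labels a b).
Proof.
rewrite inE => /and4P[NK Ng /eqP cN sN].
rewrite -odd_door_count ?card_first_ab //; congr odd.
rewrite -(@card_in_imset _ _ (fun e => N :\ e)); last first.
  move=> e e'; rewrite !inE => /andP[eN _] /andP[e'N _] /setP/(_ e).
  by rewrite !inE eqxx eN !andbT => /esym/negbFE/eqP.
apply: eq_card => M; apply/idP/imsetP; rewrite !inE.
  move=> /andP[/and4P[MK Mg /eqP cM lM] MN].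
  have : #|N :\: M| == 1%N by rewrite cardsD (setIidPr MN) cN cM subSnn.
  case/cards1P => e eE; have : e \in N :\: M by rewrite eE set11.
  have eM : M = N :\ e by rewrite -eE finset.setDDr finset.setDv finset.set0U (setIidPr MN).
  by rewrite inE => /andP[_ eN]; exists e => //; rewrite inE eN -eM.
case=> e; rewrite inE => /andP[eN lN] ->.
rewrite (triangulation_sub triK NK) ?subsetDl // lN andbT /=.
rewrite (subset_trans (subsetDl _ _) Ng) /=.
by have := cardsD1 e N; rewrite eN cN add1n => -[<-]; rewrite eqxx.
Qed.

Let rainbow_rooms : [set N in full_rooms | label @: N != first_labels a b] =
  rainbow a.+1 b.+1 a.+1 b :|: rainbow a.+1 b.+1 a b.+1.
Proof.
have inl_out : inl (Ordinal a_lt) \notin first_labels a b by rewrite inE ltnn.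
have inr_out : inr (Ordinal b_lt) \notin first_labels a b by rewrite inE ltnn.
apply/setP => N; rewrite !inE addSn addnS.
case: (N \in K) => //=; case Ng: (N \subset _) => //=; case: eqP => //= cN.
rewrite (first_labelsS_apex _ a_lt) (first_labelsS_coord _ b_lt).
apply/andP/orP => [[sL nL]|[]/eqP->]; last first.
- rewrite subsetUr; split=> //; apply: contraNneq inr_out => <-.
  by rewrite !inE eqxx.
- rewrite subsetUr; split=> //; apply: contraNneq inl_out => <-.
  by rewrite !inE eqxx.
have /properP[_ [y yN yL]] : first_labels a b \proper label @: N.
  by rewrite properEneq eq_sym nL.
have eN : label @: N = y |: first_labels a b.
  apply/esym/eqP; rewrite eqEcard subUset sub1set yN sL cardsU1 yL card_first_ab.
  by rewrite (leq_trans (leq_imset_card _ _)) // cN.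
have : y \in first_labels a.+1 b.+1.
  by case/imsetP: yN => p /(subsetP Ng)/label_grid + ->.
rewrite (first_labelsS_apex _ a_lt) (first_labelsS_coord _ b_lt)
  !in_setU1 (negPf yL) orbF eN.
by case/orP => /eqP->; [left|right].
Qed.

(* The labels of a door show that it covers all nodes except possibly the last
   apex node and the last coordinate node. *)
Let door_parity M : M \in doors ->
  odd #|[set N in full_rooms | M \subset N]| =
  (M \subset grid a b.+1) || (M \subset grid a.+1 b).
Proof.
rewrite inE => /and4P[MK Mg /eqP cM /eqP lM].
have -> : [set N in full_rooms | M \subset N] = rooms K a b M.
  apply/setP => N; rewrite !inE -lM.
  case: (N \in K) => //=; case: (N \subset _) => //=.
  have [MN|_] := boolP (M \subset N); last by rewrite andbF.
  by rewrite imsetS // !andbT.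
case: (boolP (M \subset grid a b.+1)) => [Ma|Ma].
  by rewrite (rooms_apex_boundary triK a_lt b_lt MK Ma cM).
case: (boolP (M \subset grid a.+1 b)) => [Mb|Mb].
  by rewrite (rooms_coord_boundary triK a_lt b_lt MK Mb cM).
apply/negbTE/(rooms_interior triK a_lt b_lt MK Mg cM) => [j|i].
  rewrite leq_eqVlt => /orP[/eqP ja|ja].
    have /subsetPn[[i j'] pM] := Ma; have := subsetP Mg _ pM.
    rewrite !gridE /= => /andP[-> /=]; rewrite ltnS -leqNgt => j'a aj'.
    suff -> : j = j' by exists i.
    by apply: val_inj; apply/eqP; rewrite /= ja eqn_leq aj' j'a.
  have : inl j \in label @: M by rewrite lM inE.
  case/imsetP => -[i j'] pM; rewrite /label; case: (neg _) => //= -[->].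
  by exists i.
rewrite leq_eqVlt => /orP[/eqP ib|ib].
  have /subsetPn[[i' j] pM] := Mb; have := subsetP Mg _ pM.
  rewrite !gridE /= => /andP[+ ->]; rewrite andbT ltnS -leqNgt => i'b bi'.
  suff -> : i = i' by exists j.
  by apply: val_inj; apply/eqP; rewrite /= ib eqn_leq bi' i'b.
have : inr i \in label @: M by rewrite lM inE.
case/imsetP => -[i' j] pM; rewrite /label; case: (neg _) => //= -[->].
by exists j.
Qed.

Let boundary_doors :
  [set M in doors | (M \subset grid a b.+1) || (M \subset grid a.+1 b)] =
  rainbow a b.+1 a b :|: rainbow a.+1 b a b.
Proof.
have ga : (grid a b.+1 : bigraph d n) \subset grid a.+1 b.+1.
  by apply/subsetP => p; rewrite !gridE => /andP[-> /=]; apply: ltnW.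
have gb : (grid a.+1 b : bigraph d n) \subset grid a.+1 b.+1.
  by apply/subsetP => p; rewrite !gridE => /andP[/ltnW + ->]; rewrite !ltnS => ->.
apply/setP => M; rewrite !inE.
case: (M \in K) => //=; case: (_ == _) => /=; last by rewrite !andbF.
case: (_ == _); last by rewrite !andbF.
rewrite !andbT; apply/andP/idP => [[]//|h]; split=> //.
by case/orP: h => h; apply: subset_trans h _.
Qed.

Lemma grid0_apex c : grid 0 c = finset.set0 :> bigraph d n.
Proof. by apply/setP => p; rewrite !inE ltn0 andbF. Qed.

Lemma grid0_coord c : grid c 0 = finset.set0 :> bigraph d n.
Proof. by apply/setP => p; rewrite !inE ltn0. Qed.

Lemma first_labels00 : first_labels 0 0 = finset.set0.
Proof. by apply/setP => -[]; move=> x; rewrite !inE. Qed.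

(* A face that misses both last nodes is too small to be a door, except for the
   empty face of the grid with a single edge.  This exception is the source of
   the odd parity in the end. *)
Let corner_doors :
  #|rainbow a b.+1 a b :&: rainbow a.+1 b a b| = (a + b == 0)%N.
Proof.
case: (posnP (a + b)) => [/eqP|ab0].
  rewrite addn_eq0 => /andP[/eqP a0 /eqP b0]; rewrite a0 b0.
  apply/eqP/cards1P; exists finset.set0; apply/setP => M.
  rewrite !inE grid0_apex grid0_coord first_labels00 subset0.
  by have [->|_] := eqVneq M finset.set0; rewrite ?K0 ?cards0 ?imset0 ?eqxx ?andbF.
apply/eqP; rewrite cards_eq0; apply/eqP/setP => M.
rewrite !inE; apply/negP => /andP[/and4P[MK Ma /eqP cM _] /and4P[_ Mb _ _]].
have Mab : M \subset grid a b.
  apply/subsetP => p pM; have := subsetP Ma _ pM; have := subsetP Mb _ pM.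
  by rewrite !gridE => /andP[-> _] /andP[_ ->].
case: a a_lt b b_lt ab0 cM Mab {Ma Mb MK} (MK) => [|a'] a'_lt.
  move=> b' _ + cM; rewrite grid0_apex subset0 -cM => + /eqP M0 _.
  by rewrite M0 cards0.
case=> [|b'] b'_lt ab0 cM Mab MK.
  move: Mab ab0; rewrite grid0_coord subset0 -cM => /eqP ->.
  by rewrite cards0.
have := face_card triK (ltnW a'_lt) (ltnW b'_lt) MK Mab.
by rewrite cM addSn addnS ltnn.
Qed.

Lemma rainbow_step :
  odd #|rainbow a.+1 b.+1 a.+1 b| (+) odd #|rainbow a.+1 b.+1 a b.+1| =
  odd #|rainbow a b.+1 a b| (+) odd #|rainbow a.+1 b a b| (+) (a + b == 0)%N.
Proof.
have double : (\sum_(N in full_rooms) #|[set M in doors | M \subset N]| =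
    \sum_(M in doors) #|[set N in full_rooms | M \subset N]|)%N.
  under eq_bigr do rewrite -sum1_card; under [RHS]eq_bigr do rewrite -sum1_card.
  rewrite (exchange_big_dep (mem doors)) /= => [|N M _]; last by rewrite inE => /andP[].
  apply: eq_bigr => M MD; apply: eq_bigl => N; rewrite !inE.
  by move: MD; rewrite inE => ->.
have := congr1 odd double; rewrite !odd_sum_card.
have -> : [set N in full_rooms | odd #|[set M in doors | M \subset N]|] =
    [set N in full_rooms | label @: N != first_labels a b].
  by apply/setP => N; rewrite [LHS]inE [RHS]inE; apply: andb_id2l => /room_parity.
have -> : [set M in doors | odd #|[set N in full_rooms | M \subset N]|] =
    [set M in doors | (M \subset grid a b.+1) || (M \subset grid a.+1 b)].
  by apply/setP => M; rewrite [LHS]inE [RHS]inE; apply: andb_id2l => /door_parity.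
rewrite rainbow_rooms boundary_doors !cardsU corner_doors => e.
have disj : rainbow a.+1 b.+1 a.+1 b :&: rainbow a.+1 b.+1 a b.+1 = finset.set0.
  apply/setP => N; rewrite !inE; apply/negP.
  move=> /andP[/and4P[_ _ _ /eqP ->] /and4P[_ _ _ /eqP/setP/(_ (inl (Ordinal a_lt)))]].
  by rewrite !inE ltnSn ltnn.
move: e; rewrite disj cards0 subn0 oddD => ->.
rewrite oddB ?oddD ?oddb // -corner_doors.
by rewrite (leq_trans (subset_leq_card (subsetIl _ _))) ?leq_addr.
Qed.

End Step.

Lemma addb_telescope m (f : nat -> bool) :
  \big[addb/false]_(k < m) (f k.+1 (+) f k) = f m (+) f 0%N.
Proof.
elim: m => [|m IH]; first by rewrite big_ord0 addbb.
by rewrite big_ord_recr IH /= addbC -addbA addKb.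
Qed.

Lemma addb_delta0 m : (0 < m)%N -> \big[addb/false]_(k < m) (k == 0 :> nat) = true.
Proof.
case: m => // m _; rewrite big_ord_recl /= big1 //.
Qed.

Lemma rainbow0_apex b : odd #|rainbow 0 b.+1 0 b| = (b == 0)%N.
Proof.
case: b => [|b].
  suff -> : rainbow 0 1 0 0 = [set finset.set0] by rewrite cards1.
  apply/setP => M; rewrite !inE grid0_apex first_labels00 subset0.
  by have [->|_] := eqVneq M finset.set0; rewrite ?K0 ?cards0 ?imset0 ?eqxx ?andbF.
suff -> : rainbow 0 b.+2 0 b.+1 = finset.set0 by rewrite cards0.
apply/setP => M; rewrite !inE grid0_apex subset0.
by have [->|_] := eqVneq M finset.set0; rewrite ?cards0 ?andbF.
Qed.

Lemma rainbow0_coord a : odd #|rainbow a.+1 0 a 0| = (a == 0)%N.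
Proof.
case: a => [|a].
  suff -> : rainbow 1 0 0 0 = [set finset.set0] by rewrite cards1.
  apply/setP => M; rewrite !inE grid0_coord first_labels00 subset0.
  by have [->|_] := eqVneq M finset.set0; rewrite ?K0 ?cards0 ?imset0 ?eqxx ?andbF.
suff -> : rainbow a.+2 0 a.+1 0 = finset.set0 by rewrite cards0.
apply/setP => M; rewrite !inE grid0_coord subset0.
by have [->|_] := eqVneq M finset.set0; rewrite ?cards0 ?andbF.
Qed.

(** The recursion equates the sum of two increments, one in [a] and one in [b],
    to the indicator of the pair (0, 0), so its sum over all a < n and b < d
    telescopes to boundary terms.  The terms at a = 0 and at b = 0 each contribute
    the empty face once, and cancel; the indicator contributes 1. *)
Lemma rainbow_parity : (0 < d)%N -> (0 < n)%N ->
  \big[addb/false]_(b < d) odd #|rainbow n b.+1 n b| (+)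
  \big[addb/false]_(a < n) odd #|rainbow a.+1 d a d|.
Proof.
move=> d0 n0.
pose A a b := odd #|rainbow a b.+1 a b|; pose B a b := odd #|rainbow a.+1 b a b|.
have step (a : 'I_n) (b : 'I_d) :
    (A a.+1 b (+) A a b) (+) (B a b.+1 (+) B a b) = (a == 0 :> nat) && (b == 0 :> nat).
  have := rainbow_step (ltn_ord a) (ltn_ord b).
  rewrite -/(A a.+1 b) -/(B a b.+1) -/(A a b) -/(B a b) addn_eq0.
  by case: (A a.+1 b) (B a b.+1) (A a b) (B a b) (_ && _) => -[] [] [] [].
have total : \big[addb/false]_(a < n) \big[addb/false]_(b < d)
    ((A a.+1 b (+) A a b) (+) (B a b.+1 (+) B a b)) = true.
  apply: etrans (addb_delta0 n0); apply: eq_bigr => a _.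
  rewrite (eq_bigr _ (fun b _ => step a b)).
  by case: (_ == _) => /=; [apply: addb_delta0 | rewrite big1].
have sumA : \big[addb/false]_(a < n) \big[addb/false]_(b < d) (A a.+1 b (+) A a b) =
    \big[addb/false]_(b < d) A n b (+) true.
  rewrite exchange_big /= -[X in _ (+) X](addb_delta0 d0) -big_split /=; apply: eq_bigr => b _.
  by rewrite (addb_telescope n (A^~ b)) /A rainbow0_apex.
have sumB : \big[addb/false]_(a < n) \big[addb/false]_(b < d) (B a b.+1 (+) B a b) =
    \big[addb/false]_(a < n) B a d (+) true.
  rewrite -[X in _ (+) X](addb_delta0 n0) -big_split /=; apply: eq_bigr => a _.
  by rewrite (addb_telescope d (B a)) /B rainbow0_coord.
move: total; under eq_bigr do rewrite big_split /=.
by rewrite big_split /= sumA sumB addbACA addbF.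
Qed.

Lemma rainbow_label N s t (x : 'I_n + 'I_d) : label @: N = first_labels s t ->
  x \in first_labels s t -> exists2 p, p \in N & label p = x.
Proof. by move=> <- /imsetP[p pN ->]; exists p. Qed.

Lemma spanning_labels : (0 < d)%N -> (0 < n)%N ->
  (exists2 N, N \in K & forall j : 'I_n, exists2 i, (i, j) \in N & ~~ neg (i, j)) \/
  (exists2 N, N \in K & forall i : 'I_d, exists2 j, (i, j) \in N & neg (i, j)).
Proof.
move=> d0 n0; have := rainbow_parity d0 n0.
case Ab: (\big[addb/false]_(b < d) _).
  move=> _.
  have [b /set0Pn[N]] : exists b : 'I_d, rainbow n b.+1 n b != finset.set0.
    apply/existsP; apply: contraTT isT; rewrite negb_exists => /forallP h.
    move: Ab; rewrite big1 // => b _; have := h b; rewrite negbK => /eqP ->.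
    by rewrite cards0.
  rewrite inE => /and4P[NK _ _ /eqP lN]; left; exists N => // j.
  have [|[i j'] pN] := rainbow_label (x := inl j) lN; first by rewrite inE /=.
  by rewrite /label; case: ifPn => //= nneg [<-]; exists i.
rewrite addFb => Ba.
have [a /set0Pn[N]] : exists a : 'I_n, rainbow a.+1 d a d != finset.set0.
  apply/existsP; apply: contraTT isT; rewrite negb_exists => /forallP h.
  move: Ba; rewrite big1 // => a _; have := h a; rewrite negbK => /eqP ->.
  by rewrite cards0.
rewrite inE => /and4P[NK _ _ /eqP lN]; right; exists N => // i.
have [|[i' j] pN] := rainbow_label (x := inr i) lN; first by rewrite inE /=.
by rewrite /label; case: ifPn => //= nneg [<-]; exists j.
Qed.

End Count.

(** * Positive and negative labels *)

(** A minimal nonempty subset that [f] maps into itself. *)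
Lemma permuted_subset (X : finType) (x0 : X) (f : X -> X) :
  exists2 A : {set X}, A != finset.set0 & f @: A = A.
Proof.
pose P (A : {set X}) := (A != finset.set0) && (f @: A \subset A).
have PT : P [set: X].
  by rewrite /P finset.subsetT andbT; apply/set0Pn; exists x0; rewrite inE.
case: (arg_minnP (fun A : {set X} => #|A|) PT) => A /andP[A0 fA] minA.
exists A => //; apply/eqP; rewrite eqEcard fA; apply: minA.
by rewrite /P imset_eq0 A0 imsetS.
Qed.

Section Farkas.
Variables (R : realType) (d n : nat) (T : {set bigraph d n}).
Variable Sigma : 'M[sign]_(n, d).
Hypotheses (stmT : signed_tropical_matroid R T Sigma) (fullT : full T).
Hypothesis genT : generic T.
Local Notation edge := ('I_d * 'I_n)%type.
Implicit Types (p : edge) (G H : bigraph d n).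

Definition faces : {set bigraph d n} :=
  [set G : bigraph d n | [exists H in T, G \subset H]].

Lemma faces_triangulation : flow_triangulation R faces.
Proof.
split=> [M N|G H lam mu|lam l0 lp].
- rewrite !inE => /exists_inP[H HT NH] MN; apply/exists_inP; exists H => //.
  exact: subset_trans MN NH.
- rewrite !inE => /exists_inP[G' GT /supported_weaken GG].
  move=> /exists_inP[H' HT /supported_weaken HH] l0 m0 /GG sG /HH sH.
  exact: (flow_unique stmT genT GT HT).
have [H HT hH] := flow_cover stmT fullT l0 lp.
by exists H => //; rewrite inE; apply/exists_inP; exists H.
Qed.

Definition negative p := if Sigma p.2 p.1 is SNeg then true else false.

Lemma negativeP p : reflect (Sigma p.2 p.1 = SNeg) (negative p).
Proof. by rewrite /negative; case: (Sigma _ _); constructor. Qed.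

(** Choose an edge (g j, j) of [G] that is not negative at every apex node j, and
    a negative edge (i, h i) of [H] at every coordinate node i.  On a set [A]
    permuted by g o h, the edges (i, h i) with i in [A] and the edges (g j, j)
    with j in h(A) have the same marginals, the indicators of [A] and of h(A). *)
Lemma no_both_labels G H : (0 < d)%N -> G \in T -> H \in T ->
  (forall j : 'I_n, exists2 i : 'I_d, (i, j) \in G & ~~ negative (i, j)) ->
  (forall i : 'I_d, exists2 j : 'I_n, (i, j) \in H & negative (i, j)) -> False.
Proof.
move=> d0 GT HT pos neg.
have /boolp.choice[g gP] j : exists i, (i, j) \in G /\ ~~ negative (i, j).
  by have [i] := pos j; exists i.
have /boolp.choice[h hP] i : exists j, (i, j) \in H /\ negative (i, j).
  by have [j] := neg i; exists j.
have [A A0 fA] := permuted_subset (Ordinal d0) (g \o h).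
have inj : {in A &, injective (g \o h)} by apply/imset_injP; rewrite fA.
have hinj : {in A &, injective h}.
  by move=> i i' iA i'A e; apply: inj => //=; rewrite e.
have ginj : {in h @: A &, injective g}.
  by move=> _ _ /imsetP[i iA ->] /imsetP[i' i'A ->] e; rewrite (inj i i').
have ghA : g @: (h @: A) = A by rewrite -imset_comp.
pose lam p : R := ((p.2 \in h @: A) && (p.1 == g p.2))%:R.
pose mu p : R := ((p.1 \in A) && (p.2 == h p.1))%:R.
have one (P : pred edge) (Q : pred edge) p : P p -> Q p ->
    (forall q, P q -> Q q -> q = p) -> \sum_(q | P q) (Q q)%:R = 1 :> R.
  move=> Pp Qp u; rewrite (bigD1 p) //= Qp big1 ?addr0 // => q /andP[Pq qp].
  by case: (boolP (Q q)) => // /(u q Pq) e; rewrite e eqxx in qp.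
have zero (P : pred edge) (Q : pred edge) :
    (forall q, P q -> Q q -> False) -> \sum_(q | P q) (Q q)%:R = 0 :> R.
  by move=> u; rewrite big1 // => q Pq; case: (boolP (Q q)) => // /(u q Pq).
have e : marginals lam = marginals mu.
  apply: marginals_eq => [j|i].
    have [jA|jA] := boolP (j \in h @: A); last first.
      rewrite !zero // => -[i j'] /= /eqP-> /andP[]; last by rewrite (negPf jA).
      by move=> iA /eqP e; rewrite e imset_f in jA.
    have [i iA ej] := imsetP jA.
    rewrite (one _ _ (g j, j)) ?(one _ _ (i, j)) //=.
    - by rewrite iA ej eqxx.
    - move=> [i' j'] /= /eqP-> /andP[i'A /eqP e]; congr pair.
      by apply: hinj => //; rewrite -ej -e.
    - by rewrite jA eqxx.
    - by move=> [i' j'] /= /eqP-> /andP[_ /eqP->].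
  have [iA|iA] := boolP (i \in A); last first.
    rewrite !zero // => -[i' j'] /= /eqP-> /andP[]; first by rewrite (negPf iA).
    by move=> jA /eqP e; rewrite e -ghA imset_f in iA.
  have : i \in g @: (h @: A) by rewrite ghA.
  case/imsetP => j jA ei.
  rewrite (one _ _ (i, j)) ?(one _ _ (i, h i)) //=.
  - by rewrite iA eqxx.
  - by move=> [i' j'] /= /eqP-> /andP[_ /eqP->].
  - by rewrite jA ei eqxx.
  - move=> [i' j'] /= /eqP-> /andP[j'A /eqP e]; congr pair.
    by apply: ginj => //; rewrite -ei -e.
have [i iA] := set0Pn _ A0.
have := flow_unique stmT genT (lam := lam) (mu := mu) GT HT _ _ _ _ e (i, h i).
have -> : mu (i, h i) = 1 by rewrite /mu iA eqxx.
have -> : lam (i, h i) = 0.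
  rewrite /lam /= imset_f //=; case: eqP => // eg.
  by have [_] := gP (h i); rewrite -eg (proj2 (hP i)).
move=> h01; suff : (0 : R) = 1 by move/eqP; rewrite eq_sym oner_eq0.
apply: h01 => [p|p|[i' j'] /=|[i' j'] /=]; rewrite ?ler0n //.
- by rewrite /lam /=; case: eqP => [->|]; rewrite ?andbF // (proj1 (gP j')).
- by rewrite /mu /=; case: eqP => [->|]; rewrite ?andbF // (proj1 (hP i')).
Qed.

Lemma contraction_feasibleP (I : {set 'I_d}) (G : bigraph #|I| n) :
  G \in contraction T I -> feasible (contraction_sign Sigma I) G ->
  exists2 H, H \in T & forall j : 'I_n, exists2 i : 'I_d, (i, j) \in H & ~~ negative (i, j).
Proof.
case/imsetP => H; rewrite inE => /andP[HT _] -> fea; exists H => // j.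
apply: contrapT => h; apply: fea; exists j => k; rewrite inE /= => kH.
rewrite mxE; apply/(negativeP (enum_val k, j)); apply: contrapT => /negP nk.
by apply: h; exists (enum_val k).
Qed.

Lemma feasible_contractionT H : H \in T ->
  (forall j : 'I_n, exists2 i : 'I_d, (i, j) \in H & ~~ negative (i, j)) ->
  exists2 G, G \in contraction T [set: 'I_d] &
    feasible (contraction_sign Sigma [set: 'I_d]) G.
Proof.
move=> HT pos; exists (delete_coord [set: 'I_d] H).
  apply/imsetP; exists H => //; rewrite inE HT; apply/forall_inP => p _.
  by rewrite inE.
case=> j h; have [i iH] := pos j; case/negP; apply/negativeP => /=.
have iT : i \in [set: 'I_d] by rewrite inE.
have := h (enum_rank_in iT i); rewrite inE /= enum_rankK_in // => /(_ iH).
by rewrite mxE enum_rankK_in.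
Qed.

End Farkas.

Theorem theorem68 (R : realType) (d n : nat) (d_gt0 : (0 < d)%N)
    (n_gt0 : (0 < n)%N) (T : {set bigraph d n}) (Sigma : 'M[sign]_(n, d)) :
  signed_tropical_matroid R T Sigma -> full T -> generic T ->
  exactly_one
    (exists2 I : {set 'I_d}, I != finset.set0 &
       exists2 G, G \in contraction T I & feasible (contraction_sign Sigma I) G)
    (exists2 G, G \in T & totally_infeasible Sigma G).
Proof.
move=> stmT fullT genT.
have neg_edge (H : bigraph d n) :
    (forall i : 'I_d, exists2 j : 'I_n, (i, j) \in H & Sigma j i = SNeg) ->
    forall i : 'I_d, exists2 j : 'I_n, (i, j) \in H & negative Sigma (i, j).
  by move=> h i; have [j jH /(negativeP _ (i, j))] := h i; exists j.
split; last first.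
  case=> -[I _ [G GT /(contraction_feasibleP GT)[G' G'T pos]]] [H HT [_ neg]].
  exact: (no_both_labels stmT genT d_gt0 G'T HT pos (neg_edge H neg)).
have triK := faces_triangulation stmT fullT genT.
have K0 : finset.set0 \in faces T.
  have := fullT (Ordinal d_gt0) (Ordinal n_gt0).
  case/bigcupP => H HT _; rewrite inE; apply/exists_inP; exists H => //.
  exact: sub0set.
have [[N NK pos]|[N NK neg]] := spanning_labels triK K0 (negative Sigma) d_gt0 n_gt0;
  move: NK; rewrite inE => /exists_inP[H HT /subsetP NH]; [left|right].
  exists [set: 'I_d]; first by apply/set0Pn; exists (Ordinal d_gt0); rewrite inE.
  apply: (feasible_contractionT HT) => j.
  by have [i /NH iH ?] := pos j; exists i.
have neg' i : exists2 j, (i, j) \in H & negative Sigma (i, j).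
  by have [j /NH jH ?] := neg i; exists j.
exists H => //; split; last first.
  by move=> i; have [j jH /negativeP] := neg' i; exists j.
apply: contrapT => fea.
apply: (no_both_labels stmT genT d_gt0 HT HT _ neg') => j.
apply: contrapT => h; apply: fea; exists j => i iH.
by apply/(negativeP _ (i, j)); apply: contrapT => /negP ni; apply: h; exists i.
Qed.
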